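(* Let $d_1>d_2>\cdots>d_r\geq 2$ be integers and let $b_{d_1},\dots,b_{d_r}\ge 1$ be positive integers. The polynomial equation $x=z-\sum_{i=1}^r b_{d_i}z^{d_i}$ has reverse series $z=\sum_{n=0}^{\infty} a_n x^{n+1}$, where for every $n\ge 0$, $a_n$ equals the number of colored polygonal $(d_1,d_2,\dots,d_r)$-dissections of a convex $(n+2)$-gon.
   Context: The reverse series is the unique formal power series $z(x)$ with $z(0)=0$ satisfying the equation. A polygonal dissection of a convex polygon (with fixed vertices) is the union of the polygon with a set of pairwise non-crossing diagonals. A $(d_1,\dots,d_r)$-dissection is one in which every region is a $(d+1)$-gon for some $d\in\{d_1,\dots,d_r\}$. A colored $(d_1,\dots,d_r)$-dissection is such a dissection together with an assignment to each region that is a $(d_i+1)$-gon of one of $b_{d_i}$ available colors. By convention, for $n=0$ the degenerate $2$-gon has exactly one (empty, uncolored) dissection. *)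

(* Defs.v *)
From HB Require Import structures.
From mathcomp Require Import all_boot all_order all_algebra.

Set Implicit Arguments.
Unset Strict Implicit.
Unset Printing Implicit Defensive.

Import GRing.Theory.
Local Open Scope ring_scope.

(* A formal power series over R is its sequence of coefficients. *)
Definition fps (R : comNzRingType) : Type := nat -> R.

Definition fps_one (R : comNzRingType) : fps R := fun n => (n == 0%N)%:R.

Definition fps_X (R : comNzRingType) : fps R := fun n => (n == 1%N)%:R.

Definition fps_mul (R : comNzRingType) (f g : fps R) : fps R :=
  fun n => \sum_(i < n.+1) f i * g (n - i)%N.

Definition fps_exp (R : comNzRingType) (f : fps R) (k : nat) : fps R :=
  iter k (fps_mul f) (fps_one R).

(* z(0) = 0 and x = z - \sum_i b_{d_i} z^{d_i}, coefficient by coefficient;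
   b is indexed by the values d i, not by i. *)
Definition solves_equation (R : comNzRingType) (r : nat) (d : 'I_r -> nat)
    (b : nat -> nat) (z : fps R) : Prop :=
  z 0%N = 0 /\
  forall n, fps_X R n = z n - \sum_(i < r) (b (d i))%:R * fps_exp z (d i) n.

Definition is_reverse_series (R : comNzRingType) (r : nat) (d : 'I_r -> nat)
    (b : nat -> nat) (z : fps R) : Prop :=
  solves_equation d b z /\
  forall w : fps R, solves_equation d b w -> w =1 z.

Local Open Scope nat_scope.

(* The vertices of the convex m-gon are 'I_m in cyclic order. A segment
   between two distinct vertices is the pair of its endpoints, smaller first. *)
Definition is_segment (m : nat) (e : 'I_m * 'I_m) : bool := e.1 < e.2.

Definition is_side (m : nat) (e : 'I_m * 'I_m) : bool :=
  is_segment e &&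
  ((e.2 == e.1.+1 :> nat) || (e.1 == 0 :> nat) && (e.2 == m.-1 :> nat)).

Definition is_diagonal (m : nat) (e : 'I_m * 'I_m) : bool :=
  is_segment e && ~~ is_side e.

(* Crossing in the interior of the polygon: sharing an endpoint is allowed. *)
Definition crossing (m : nat) (e f : 'I_m * 'I_m) : bool :=
  [&& e.1 < f.1, f.1 < e.2 & e.2 < f.2] ||
  [&& f.1 < e.1, e.1 < f.2 & f.2 < e.2].

(* The diagonals being non-crossing, their set is determined by their union. *)
Definition is_dissection (m : nat) (D : {set 'I_m * 'I_m}) : bool :=
  [forall e in D, is_diagonal e] &&
  [forall e in D, forall f in D, ~~ crossing e f].

(* All vertices in S lie in the same closed half-plane bounded by the line
   through the endpoints of the segment e. *)
Definition on_one_side (m : nat) (e : 'I_m * 'I_m) (S : {set 'I_m}) : bool :=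
  [forall k in S, e.1 <= k <= e.2] || [forall k in S, ~~ (e.1 < k < e.2)].

(* The segment e joins two vertices in S and is an edge of the convex hull
   of S. *)
Definition is_hull_edge (m : nat) (S : {set 'I_m}) (e : 'I_m * 'I_m) : bool :=
  [&& is_segment e, e.1 \in S, e.2 \in S & on_one_side e S].

(* A region of D is given by the set S of its vertices, and is then a
   #|S|-gon: no diagonal in D meets the interior of the convex hull of S, and
   the boundary of that hull consists of sides of the m-gon and diagonals
   in D. A 2-gon has no region. *)
Definition is_region (m : nat) (D : {set 'I_m * 'I_m}) (S : {set 'I_m}) : bool :=
  [&& 3 <= #|S|,
      [forall e in D, on_one_side e S]
    & [forall e, is_hull_edge S e ==> is_side e || (e \in D)]].

Definition is_d_dissection (r : nat) (d : 'I_r -> nat) (m : nat)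
    (D : {set 'I_m * 'I_m}) : bool :=
  is_dissection D &&
  [forall S, is_region D S ==> [exists i, #|S| == (d i).+1]].

Definition d_dissection (r : nat) (d : 'I_r -> nat) (m : nat) : finType :=
  {D : {set 'I_m * 'I_m} | is_d_dissection d D}.

Definition region (m : nat) (D : {set 'I_m * 'I_m}) : finType :=
  {S : {set 'I_m} | is_region D S}.

Definition coloring (b : nat -> nat) (m : nat) (D : {set 'I_m * 'I_m}) :
    finType :=
  {dffun forall S : region D, 'I_(b #|val S|.-1)}.

Definition colored_dissection (r : nat) (d : 'I_r -> nat) (b : nat -> nat)
    (m : nat) : finType :=
  {D : d_dissection d m & coloring b (val D)}.

Definition num_colored_dissections (r : nat) (d : 'I_r -> nat)
    (b : nat -> nat) (n : nat) : nat :=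
  #|{: colored_dissection d b n.+2}|.

(* Main.v *)
(* Idea: the coefficient of [x^n] in [z^k] counts chains of [k] colored dissected
   polygons, glued at vertices, whose base edges form a path from one end of an
   interval of [n] steps to the other. Such a chain is encoded by the set of all
   non-side segments it draws (base edges included), an "arc configuration";
   each arc is the longest edge of exactly one region, so the number of colorings
   is a product over arcs. Cutting a chain at the first interior vertex of its path
   is multiplication by [z]; removing the outermost arc of a chain of length one
   leaves a chain of length [d] for some [d] in [d_1, .., d_r], which is the
   equation [z = x + \sum_i b_{d_i} z^{d_i}]. *)
Require Import Defs.
From HB Require Import structures.
From mathcomp Require Import all_boot all_order all_algebra zify.

Set Implicit Arguments.
Unset Strict Implicit.
Unset Printing Implicit Defensive.

Import GRing.Theory.
Local Open Scope nat_scope.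

(* [lia] compares atoms syntactically, while unification leaves the components
   of a pair annotated with [Finite.sort _] instead of ['I_N]. *)
Ltac arc_lia :=
  intros;
  repeat match goal with
  | H : context [@nat_of_ord ?N (@fst ?A ?B ?e)] |- _ =>
      lazymatch constr:((A, B)) with (ordinal _, ordinal _) => fail | _ => idtac end;
      change (@fst A B e) with (@fst (ordinal N) (ordinal N) e) in H
  | H : context [@nat_of_ord ?N (@snd ?A ?B ?e)] |- _ =>
      lazymatch constr:((A, B)) with (ordinal _, ordinal _) => fail | _ => idtac end;
      change (@snd A B e) with (@snd (ordinal N) (ordinal N) e) in H
  | |- context [@nat_of_ord ?N (@fst ?A ?B ?e)] =>
      lazymatch constr:((A, B)) with (ordinal _, ordinal _) => fail | _ => idtac end;
      change (@fst A B e) with (@fst (ordinal N) (ordinal N) e)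
  | |- context [@nat_of_ord ?N (@snd ?A ?B ?e)] =>
      lazymatch constr:((A, B)) with (ordinal _, ordinal _) => fail | _ => idtac end;
      change (@snd A B e) with (@snd (ordinal N) (ordinal N) e)
  end;
  lia.

(** * Arc configurations *)

Definition noncrossing N (D : {set 'I_N * 'I_N}) : bool :=
  [forall e in D, forall f in D, ~~ crossing e f].

(** Sides between consecutive vertices are excluded, but the pair [(i, j)] itself is allowed: it is
    the base edge of a chain of length one. *)
Definition arc_config N (i j : 'I_N) (D : {set 'I_N * 'I_N}) : bool :=
  [forall e in D, [&& i <= e.1, e.1.+1 < e.2 & e.2 <= j]] && noncrossing D.

(** The vertices of the path formed by the base edges; [top_length] subtracts one to count its
    edges. *)
Definition uncovered N (i j : 'I_N) (D : {set 'I_N * 'I_N}) : {set 'I_N} :=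
  [set k : 'I_N | (i <= k <= j) && [forall e in D, ~~ (e.1 < k < e.2)]].

Definition top_length N (i j : 'I_N) (D : {set 'I_N * 'I_N}) : nat :=
  #|uncovered i j D|.-1.

Definition below N (D : {set 'I_N * 'I_N}) (e : 'I_N * 'I_N) :=
  [set f in D | [&& e.1 <= f.1, f.2 <= e.2 & f != e]].

(** The region with longest edge [e] has [top_length e.1 e.2 (below D e)] further edges; [c k]
    stands for the number of colors of a [k.+1]-gon. *)
Definition weight (c : nat -> nat) N (D : {set 'I_N * 'I_N}) : nat :=
  \prod_(e in D) c (top_length e.1 e.2 (below D e)).

Definition total_weight (c : nat -> nat) k N (i j : 'I_N) : nat :=
  \sum_(D | arc_config i j D && (top_length i j D == k)) weight c D.

Lemma arc_eq N (e f : 'I_N * 'I_N) :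
  e.1 = f.1 :> nat -> e.2 = f.2 :> nat -> e = f.
Proof.
by case: e f => [e1 e2] [f1 f2] /= h1 h2; congr pair; apply: val_inj.
Qed.

Lemma noncrossingP N (D : {set 'I_N * 'I_N}) :
  reflect {in D &, forall e f : 'I_N * 'I_N, ~~ crossing e f} (noncrossing D).
Proof.
apply: (iffP forall_inP) => [h e f eD fD|h e eD]; first exact: (forall_inP (h e eD)).
by apply/forall_inP => f fD; apply: h.
Qed.

Lemma arc_configP N (i j : 'I_N) (D : {set 'I_N * 'I_N}) :
  reflect ({in D, forall e : 'I_N * 'I_N, [/\ i <= e.1, e.1.+1 < e.2 & e.2 <= j]} /\
           {in D &, forall e f : 'I_N * 'I_N, ~~ crossing e f}) (arc_config i j D).
Proof.
apply: (iffP andP) => [] [hD /noncrossingP nD]; split=> //.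
  by move=> e /(forall_inP hD) /and3P.
by apply/forall_inP => e eD; apply/and3P/hD.
Qed.

Lemma uncoveredP N (i j k : 'I_N) (D : {set 'I_N * 'I_N}) :
  reflect (i <= k <= j /\ {in D, forall e : 'I_N * 'I_N, ~~ (e.1 < k < e.2)})
          (k \in uncovered i j D).
Proof. by rewrite inE; apply: (iffP andP) => [] [-> /forall_inP]. Qed.

Lemma uncovered_left N (i j : 'I_N) (D : {set 'I_N * 'I_N}) :
  i <= j -> arc_config i j D -> i \in uncovered i j D.
Proof.
move=> ij /arc_configP[hD _]; apply/uncoveredP; split=> [|e /hD[]]; lia.
Qed.

Lemma uncovered_right N (i j : 'I_N) (D : {set 'I_N * 'I_N}) :
  i <= j -> arc_config i j D -> j \in uncovered i j D.
Proof.
move=> ij /arc_configP[hD _]; apply/uncoveredP; split=> [|e /hD[]]; lia.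
Qed.

Lemma arc_config_below N (i j : 'I_N) (D : {set 'I_N * 'I_N}) e :
  arc_config i j D -> arc_config e.1 e.2 (below D e).
Proof.
case/arc_configP=> hD nD; apply/arc_configP; split=> [f|f g].
  by rewrite !inE => /and4P[/hD[_ ? _] ? ? _].
by rewrite !inE => /andP[fD _] /andP[gD _]; apply: nD.
Qed.

(* The longest arc at [i] ends at [j]: otherwise its right end would have to be
   covered by an arc that is longer or crosses it. *)
Lemma arc_of_covered N (i j : 'I_N) (D : {set 'I_N * 'I_N}) :
  i.+1 < j -> arc_config i j D ->
  (forall k : 'I_N, i < k < j -> exists2 e, e \in D & e.1 < k < e.2) ->
  (i, j) \in D.
Proof.
move=> ij /arc_configP[hD nD] hcov.
have i1N : i.+1 < N by have := ltn_ord j; lia.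
(* An arc over the successor of [i] can only start at [i], so some arc starts there. *)
have [e0 e0D he0] := hcov (Ordinal i1N) ltac:(rewrite /=; lia).
have e01 : e0.1 == i by apply/eqP/val_inj; have [] := hD _ e0D; move: he0 => /=; lia.
have P0 : (e0 \in D) && (e0.1 == i) by rewrite e0D.
case: (@arg_maxnP _ e0 (fun e => (e \in D) && (e.1 == i))
         (fun e => nat_of_ord e.2) P0) => e /andP[eD /eqP e1i] emax.
have [_ _ e2j] := hD _ eD.
suff e2E : e.2 = j :> nat
  by rewrite (_ : (i, j) = e) //; apply: arc_eq; rewrite //= e1i.
apply/eqP; rewrite eqn_leq e2j leqNgt; apply/negP => e2lt.
have [_ e12 _] := hD _ eD.
have ie2 : i.+1 < e.2 by rewrite -e1i.
have [f fD hf] := hcov e.2 ltac:(lia).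
have [f1 _ _] := hD _ fD.
have [f1i|f1i] := eqVneq f.1 i.
  have := emax f; rewrite fD f1i eqxx => /(_ isT); lia.
have := nD _ _ eD fD; rewrite /crossing e1i hf andbT ltn_neqAle f1 andbT.
by rewrite val_eqE eq_sym f1i.
Qed.

(** A path with one edge leaves every vertex strictly between [i] and [j] covered, and
    [arc_of_covered] then produces the arc; conversely that arc covers them all. *)
Lemma top_length_eq1 N (i j : 'I_N) (D : {set 'I_N * 'I_N}) :
  i.+1 < j -> arc_config i j D -> (top_length i j D == 1) = ((i, j) \in D).
Proof.
move=> ij aD; have lij : i <= j by lia.
have sub : [set i; j] \subset uncovered i j D.
  apply/subsetP => k; rewrite in_set2 => /orP[]/eqP->.
    by rewrite uncovered_left.
  by rewrite uncovered_right.
have c2 : #|[set i; j]| = 2.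
  by rewrite cards2; have [e|//] := eqVneq i j; rewrite e in ij; lia.
have ge2 := subset_leq_card sub; rewrite c2 in ge2.
apply/idP/idP => [/eqP t1|ijD].
  have eqV : [set i; j] = uncovered i j D.
    apply/eqP; rewrite eqEcard sub c2; move: t1; rewrite /top_length.
    by case: #|_| => [|[|[]]].
  apply: arc_of_covered => // k kij.
  have : k \notin uncovered i j D.
    rewrite -eqV !inE negb_or; apply/andP; split; apply/eqP=> e; rewrite e in kij; lia.
  rewrite inE negb_and => /orP[|]; first by lia.
  by rewrite negb_forall_in => /exists_inP[e eD]; rewrite negbK => h; exists e.
suff eqV : [set i; j] = uncovered i j D by rewrite /top_length -eqV c2.
apply/eqP; rewrite eqEsubset sub; apply/subsetP => k /uncoveredP[kij /(_ _ ijD)] /= hk.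
rewrite !inE -!val_eqE /=; lia.
Qed.

Lemma arc_config_interval_unit N (i j : 'I_N) (D : {set 'I_N * 'I_N}) :
  j <= i.+1 -> arc_config i j D = (D == set0).
Proof.
move=> ij; apply/arc_configP/eqP => [[hD _]|->]; last by split=> e; rewrite !inE.
by apply/setP => e; rewrite inE; apply/negP => /hD[]; lia.
Qed.

Lemma uncovered0 N (i j : 'I_N) : uncovered i j set0 = [set k : 'I_N | i <= k <= j].
Proof.
apply/setP => k; rewrite !inE; case: (_ <= _ <= _) => //=.
by apply/forall_inP => e; rewrite inE.
Qed.

Lemma weight0 c N : weight c (set0 : {set 'I_N * 'I_N}) = 1.
Proof. by rewrite /weight big_set0. Qed.

Lemma total_weight_point c k N (i : 'I_N) : total_weight c k i i = (k == 0).
Proof.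
have t0 : top_length i i set0 = 0.
  rewrite /top_length uncovered0 (_ : [set _ | _] = [set i]) ?cards1 //.
  by apply/setP => k'; rewrite !inE -val_eqE /=; lia.
rewrite /total_weight.
under eq_bigl => D do rewrite arc_config_interval_unit //.
rewrite big_mkcondr /= big_pred1_eq t0 weight0 eq_sym; by case: eqP.
Qed.

Lemma total_weight_unit c N (i j : 'I_N) :
  j = i.+1 :> nat -> total_weight c 1 i j = 1.
Proof.
move=> ij.
have t1 : top_length i j set0 = 1.
  rewrite /top_length uncovered0 (_ : [set _ | _] = [set i; j]).
    by rewrite cards2 -val_eqE /= ij; lia.
  by apply/setP => k'; rewrite !inE -!val_eqE /=; lia.
rewrite /total_weight.
under eq_bigl => D do rewrite arc_config_interval_unit ?ij //.
by rewrite big_mkcondr /= big_pred1_eq t1 weight0.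
Qed.

Lemma total_weight_len0 c N (i j : 'I_N) : i < j -> total_weight c 0 i j = 0.
Proof.
move=> ij; apply: big1 => D /andP[aD].
have lij := ltnW ij.
have : #|[set i; j]| <= #|uncovered i j D|.
  apply/subset_leq_card/subsetP => k; rewrite in_set2 => /orP[]/eqP->.
    by rewrite uncovered_left.
  by rewrite uncovered_right.
rewrite cards2 /top_length -val_eqE /=; lia.
Qed.

(** * Splitting at the first uncovered vertex *)

Definition left_part N (v : 'I_N) (D : {set 'I_N * 'I_N}) :=
  [set e in D | e.2 <= v].

Definition right_part N (v : 'I_N) (D : {set 'I_N * 'I_N}) :=
  [set e in D | v <= e.1].

Lemma arc_config_left_part N (i j v : 'I_N) (D : {set 'I_N * 'I_N}) :
  arc_config i j D -> arc_config i v (left_part v D).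
Proof.
case/arc_configP=> hD nD; apply/arc_configP; split=> [e|e f].
  by rewrite inE => /andP[/hD[? ? _] ?].
by rewrite !inE => /andP[eD _] /andP[fD _]; apply: nD.
Qed.

Lemma arc_config_right_part N (i j v : 'I_N) (D : {set 'I_N * 'I_N}) :
  arc_config i j D -> arc_config v j (right_part v D).
Proof.
case/arc_configP=> hD nD; apply/arc_configP; split=> [e|e f].
  by rewrite inE => /andP[/hD[_ ? ?] ?].
by rewrite !inE => /andP[eD _] /andP[fD _]; apply: nD.
Qed.

Lemma setU_left_right_part N (i j v : 'I_N) (D : {set 'I_N * 'I_N}) :
  v \in uncovered i j D -> left_part v D :|: right_part v D = D.
Proof.
move=> /uncoveredP[_ vD]; apply/setP => e; rewrite !inE.
case eD: (e \in D) => //=; have := vD _ eD; lia.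
Qed.

Section Union.
Variables (N : nat) (i v j : 'I_N) (D1 D2 : {set 'I_N * 'I_N}).
Hypotheses (aD1 : arc_config i v D1) (aD2 : arc_config v j D2).
Hypotheses (iv : i <= v) (vj : v <= j).

Lemma arc_config_setU : arc_config i j (D1 :|: D2).
Proof.
case/arc_configP: aD1 => h1 n1; case/arc_configP: aD2 => h2 n2.
apply/arc_configP; split=> [e|e f].
  by rewrite inE => /orP[/h1|/h2] [*]; split; lia.
rewrite !inE => /orP[] he /orP[] hf; [exact: n1| | |exact: n2].
- by have := h1 _ he; have := h2 _ hf; rewrite /crossing; case=> + + + []; lia.
- by have := h2 _ he; have := h1 _ hf; rewrite /crossing; case=> + + + []; lia.
Qed.

Lemma left_part_setU : left_part v (D1 :|: D2) = D1.
Proof.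
case/arc_configP: aD1 => h1 n1; case/arc_configP: aD2 => h2 n2.
apply/setP => e; rewrite !inE; case e1: (e \in D1).
  by have [_ _ ->] := h1 _ e1.
by case e2: (e \in D2) => //=; have [] := h2 _ e2; lia.
Qed.

Lemma right_part_setU : right_part v (D1 :|: D2) = D2.
Proof.
case/arc_configP: aD1 => h1 n1; case/arc_configP: aD2 => h2 n2.
apply/setP => e; rewrite !inE; case e2: (e \in D2).
  by have [-> _ _] := h2 _ e2; rewrite orbT.
by case e1: (e \in D1) => //=; have [] := h1 _ e1; lia.
Qed.

Lemma uncovered_setU :
  uncovered i j (D1 :|: D2) = uncovered i v D1 :|: uncovered v j D2.
Proof.
case/arc_configP: aD1 => h1 n1; case/arc_configP: aD2 => h2 n2.
apply/setP => k; rewrite in_setU; apply/uncoveredP/orP.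
  case=> kij hk; have [kv|vk] := leqP k v; [left|right]; apply/uncoveredP.
    by split=> [|e eD]; [lia|apply: hk; rewrite inE eD].
  by split=> [|e eD]; [lia|apply: hk; rewrite inE eD orbT].
case=> /uncoveredP[kb hk].
  split=> [|e]; first by lia.
  by rewrite inE => /orP[/hk//|/h2[]]; lia.
split=> [|e]; first by lia.
by rewrite inE => /orP[/h1[]|/hk//]; lia.
Qed.

(** The two paths share exactly the vertex [v], so their numbers of edges add. *)
Lemma top_length_setU :
  top_length i j (D1 :|: D2) = top_length i v D1 + top_length v j D2.
Proof.
rewrite /top_length uncovered_setU cardsU.
have -> : uncovered i v D1 :&: uncovered v j D2 = [set v].
  apply/setP => k; rewrite in_setI in_set1; apply/andP/eqP => [[]|->].
    by move=> /uncoveredP[k1 _] /uncoveredP[k2 _]; apply: val_inj => /=; lia.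
  by rewrite uncovered_right ?uncovered_left.
have c1 : 0 < #|uncovered i v D1|.
  by apply/card_gt0P; exists v; rewrite uncovered_right.
have c2 : 0 < #|uncovered v j D2|.
  by apply/card_gt0P; exists v; rewrite uncovered_left.
rewrite cards1; lia.
Qed.

Lemma below_setUl e : e \in D1 -> below (D1 :|: D2) e = below D1 e.
Proof.
case/arc_configP: aD1 => h1 n1; case/arc_configP: aD2 => h2 n2 eD.
apply/setP => f; rewrite !inE; case: (f \in D1) => //=.
case fD: (f \in D2) => //=; have := h1 _ eD; have := h2 _ fD => -[? ? ?] [? ? ?].
by apply/negP => /and3P[]; lia.
Qed.

Lemma below_setUr e : e \in D2 -> below (D1 :|: D2) e = below D2 e.
Proof.
case/arc_configP: aD1 => h1 n1; case/arc_configP: aD2 => h2 n2 eD.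
apply/setP => f; rewrite !inE; case: (f \in D2); rewrite ?orbT ?orbF //=.
case fD: (f \in D1) => //=; have := h1 _ fD; have := h2 _ eD => -[? ? ?] [? ? ?].
by apply/negP => /and3P[]; lia.
Qed.

(** An arc on one side of [v] never lies below an arc on the other, so each region keeps its
    edges. *)
Lemma weight_setU c : weight c (D1 :|: D2) = weight c D1 * weight c D2.
Proof.
rewrite /weight.
under eq_bigl => e do rewrite in_setU.
rewrite bigU /=; last first.
  case/arc_configP: aD1 => h1 n1; case/arc_configP: aD2 => h2 n2.
  rewrite disjoint_subset; apply/subsetP => e /h1[? ? ?].
  by rewrite inE; apply/negP => /h2[]; lia.
congr (_ * _); apply: eq_bigr => e eD; first by rewrite below_setUl.
by rewrite below_setUr.
Qed.

End Union.

(** [D] corresponds to [(left_part v D, right_part v D)], where [v] is the first uncovered vertex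
    after [i]; no arc passes over [v], so nothing is lost. *)
Lemma total_weight_succ c k N (i j : 'I_N) : i < j ->
  total_weight c k.+1 i j =
  \sum_(v : 'I_N | i < v <= j) total_weight c 1 i v * total_weight c k v j.
Proof.
move=> ij.
(* Being the next uncovered vertex after [i] is expressed by a left part of length one, the
   condition occurring in [total_weight c 1 i v]. *)
pose first (D : {set 'I_N * 'I_N}) (v : 'I_N) :=
  [&& i < v <= j, v \in uncovered i j D & top_length i v (left_part v D) == 1].
have first_ex D : arc_config i j D -> exists v, first D v.
  move=> aD; have P0 : (j \in uncovered i j D) && (i < j).
    by rewrite uncovered_right // ltnW.
  case: (@arg_minnP _ j (fun v => (v \in uncovered i j D) && (i < v))
           (fun v => nat_of_ord v) P0) => v /andP[vU iv] vmin.
  have vb : i < v <= j by move/uncoveredP: (vU) => [+ _]; lia.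
  exists v; rewrite /first vb vU /=.
  have aL := arc_config_left_part v aD.
  suff -> : top_length i v (left_part v D) = #|[set i; v]|.-1.
    by rewrite cards2 -val_eqE /=; lia.
  rewrite /top_length; congr (#|pred_of_set _|.-1); apply/setP => w; rewrite in_set2.
  apply/idP/idP => [wU|/orP[]/eqP->]; last first.
  - by rewrite uncovered_right // ltnW; case/andP: vb.
  - by rewrite uncovered_left // ltnW; case/andP: vb.
  rewrite -!val_eqE /= -[_ || _]negbK negb_or; apply/negP => /andP[wi wv].
  have /uncoveredP[wb hw] := wU.
  have /uncoveredP[_ hv] := vU.
  (* An arc over [w] ending beyond [v] would also cover [v]; hence [w] is uncovered in [D], against
     the minimality of [v]. *)
  suff wU' : w \in uncovered i j D by have := vmin w; rewrite wU' /=; lia.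
  apply/uncoveredP; split=> [|e eD]; first by lia.
  have [ev|ev] := leqP e.2 v; first by apply: hw; rewrite inE eD.
  have /= := hv e eD; rewrite ev andbT -leqNgt => ve.
  by rewrite ltnNge (leq_trans _ ve) //; case/andP: wb.
have first_uniq D v w : arc_config i j D -> first D v -> first D w -> v = w.
  move=> aD.
  wlog vw : v w / v <= w.
    move=> H fv fw; have [vw|/ltnW wv] := leqP v w; first exact: H.
    by apply/esym/H.
  case/and3P=> vb vU _ /and3P[wb wU /eqP tw]; apply/eqP/negPn/negP => nvw.
  (* Three uncovered vertices are one too many for a left part of length one. *)
  have sub : [set i; v; w] \subset uncovered i w (left_part w D).
    have aL := arc_config_left_part w aD.
    apply/subsetP => x; rewrite in_setU in_set2 in_set1 -orbA => /or3P[]/eqP->.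
    - by rewrite uncovered_left // ltnW; case/andP: wb.
    - apply/uncoveredP; split=> [|e]; first by lia.
      by rewrite inE => /andP[eD _]; have /uncoveredP[_ ->] := vU.
    - by rewrite uncovered_right // ltnW; case/andP: wb.
  have := subset_leq_card sub; rewrite -setUA cardsU1 cards2 nvw in_set2.
  rewrite -!val_eqE /= (_ : (_ || _) = false); last by lia.
  by move: tw; rewrite /top_length; case: #|_| => [|[|[]]].
rewrite /total_weight.
(* The default [j] is never reached on arc configurations, by [first_ex]. *)
pose p D := odflt j [pick v | first D v].
rewrite (partition_big p (fun v : 'I_N => i < v <= j)); last first.
  move=> D /andP[_ _]; rewrite /p; case: pickP => [v /and3P[]//|_] /=.
  by rewrite ij leqnn.
apply: eq_bigr => v vb; rewrite big_distrlr /= pair_big_dep /=.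
have [iv vj] : i <= v /\ v <= j by lia.
rewrite (reindex_onto (fun q => q.1 :|: q.2)
           (fun D => (left_part v D, right_part v D))).
  apply: eq_big => [[D1 D2]|[D1 D2]] /=; last first.
    case/andP=> /andP[/andP[aD _] _] /eqP[E1 E2].
    have a1 := arc_config_left_part v aD; have a2 := arc_config_right_part v aD.
    by rewrite E1 in a1; rewrite E2 in a2; rewrite (weight_setU a1 a2).
  apply/idP/idP.
    case/andP=> /andP[/andP[aD /eqP tD] /eqP pD] /eqP[E1 E2].
    have a1 := arc_config_left_part v aD; have a2 := arc_config_right_part v aD.
    rewrite E1 in a1; rewrite E2 in a2; rewrite a1 a2 /=.
    have fv : first (D1 :|: D2) v.
      move: pD; rewrite /p; case: pickP => [u fu /= <- //|no].
      by have [u] := first_ex _ aD; rewrite no.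
    have /and3P[_ _] := fv; rewrite E1 => t1; rewrite t1 /=.
    move: tD; rewrite (top_length_setU a1 a2 iv vj) (eqP t1) add1n => -[->].
    exact: eqxx.
  case/andP=> /andP[a1 t1] /andP[a2 t2].
  have aD := arc_config_setU a1 a2 iv vj.
  rewrite aD (top_length_setU a1 a2 iv vj) (eqP t1) (eqP t2) add1n eqxx /=.
  have E1 := left_part_setU a1 a2 iv vj; have E2 := right_part_setU a1 a2 iv vj.
  rewrite E1 E2 eqxx andbT /p.
  have fv : first (D1 :|: D2) v.
    rewrite /first vb E1 t1 andbT /= (uncovered_setU a1 a2 iv vj).
    by rewrite in_setU uncovered_right.
  case: pickP => [u fu|/(_ v)]; last by rewrite fv.
  by apply/eqP/(first_uniq _ _ _ aD).
move=> D /andP[/andP[aD _]] /eqP; rewrite /p.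
case: pickP => [u /and3P[_ uU _] /= <-|no]; last first.
  by have [u] := first_ex _ aD; rewrite no.
by rewrite (setU_left_right_part uU).
Qed.

(** * Removing the outermost arc *)

Lemma arc_config_setU1 N (i j : 'I_N) (D : {set 'I_N * 'I_N}) :
  i.+1 < j -> arc_config i j ((i, j) |: D) = arc_config i j D.
Proof.
move=> ij; apply/arc_configP/arc_configP => -[hD nD]; split=> [e|e f].
- by move=> eD; apply: hD; rewrite inE eD orbT.
- by move=> eD fD; apply: nD; rewrite inE ?eD ?fD orbT.
- by rewrite !inE => /orP[/eqP-> //|/hD].
rewrite !inE => /orP[/eqP->|eD] /orP[/eqP->|fD].
- by rewrite /crossing; lia.
- by have [] := hD _ fD; rewrite /crossing /=; lia.
- by have [] := hD _ eD; rewrite /crossing /=; lia.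
- exact: nD.
Qed.

Lemma below_root N (i j : 'I_N) (D : {set 'I_N * 'I_N}) :
  arc_config i j D -> below ((i, j) |: D) (i, j) = D :\ (i, j).
Proof.
case/arc_configP=> hD _; apply/setP => f; rewrite !inE andbC.
have [//|nf] := eqVneq f (i, j); rewrite /= ?andbF //.
by case fD: (f \in D); rewrite ?andbF //; have [-> _ ->] := hD _ fD.
Qed.

Lemma below_setU1 N (i j : 'I_N) (D : {set 'I_N * 'I_N}) e :
  arc_config i j D -> e \in D -> below ((i, j) |: D) e = below D e.
Proof.
case/arc_configP=> hD _ eD; apply/setP => f; rewrite !inE.
have [->|//] := eqVneq f (i, j); case: ((i, j) \in D) => //=.
apply/negP => /and3P[e1 e2 /eqP]; have [? ? ?] := hD _ eD.
by apply; apply: arc_eq => /=; lia.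
Qed.

(** The new region is bounded by [(i, j)] and the path of [D]; the other regions do not change,
    since [(i, j)] lies below no arc of [D]. *)
Lemma weight_setU1 c N (i j : 'I_N) (D : {set 'I_N * 'I_N}) :
  arc_config i j D -> (i, j) \notin D ->
  weight c ((i, j) |: D) = c (top_length i j D) * weight c D.
Proof.
move=> aD nD; rewrite /weight big_setU1 //= below_root //.
congr (c (top_length i j _) * _).
  by apply/setDidPl; rewrite disjoint_sym disjoints1.
by apply: eq_bigr => e eD; rewrite (below_setU1 aD).
Qed.

Lemma total_weight1 c N (i j : 'I_N) : i.+1 < j ->
  total_weight c 1 i j =
  \sum_(D | arc_config i j D && ((i, j) \notin D)) weight c ((i, j) |: D).
Proof.
move=> ij; rewrite /total_weight.
rewrite (reindex_onto (fun D => (i, j) |: D) (fun D => D :\ (i, j))) /=.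
  apply: eq_bigl => D; rewrite arc_config_setU1 //.
  case aD: (arc_config i j D) => //=.
  rewrite top_length_eq1 ?arc_config_setU1 // setU11 /= eqEsubset.
  rewrite subDset subxx /= subsetD1 andbC.
  by case: (_ \notin D) => //=; apply/subsetP => x xD; rewrite inE xD orbT.
by move=> D /andP[aD]; rewrite top_length_eq1 // => ijD; rewrite setD1K.
Qed.

(** What remains under the outermost arc is sorted by its length [k]; the factor [c k] is zero
    unless [k] is some [d x]. *)
Lemma total_weight1_rec r (d : 'I_r -> nat) (b : nat -> nat) N (i j : 'I_N) :
  (forall x, 2 <= d x) -> i.+1 < j ->
  let c k := \sum_(x < r | d x == k) b (d x) in
  total_weight c 1 i j = \sum_(x < r) b (d x) * total_weight c (d x) i j.
Proof.
move=> d2 ij c; rewrite total_weight1 //.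
under eq_bigr => D /andP[aD nD] do rewrite weight_setU1 //.
under [RHS]eq_bigr => x _ do rewrite /total_weight big_distrr big_mkcondr /=.
rewrite exchange_big /= big_mkcondr; apply: eq_bigr => D aD /=.
have [ijD|_] := boolP ((i, j) \in D).
  (* A configuration containing [(i, j)] has length one, which is no [d x]. *)
  rewrite big1 // => x _; rewrite -top_length_eq1 // in ijD.
  by rewrite (eqP ijD); have := d2 x; case: eqP => // <-.
rewrite -big_mkcond /= /c big_distrl /=.
by apply: eq_bigl => x; rewrite eq_sym.
Qed.

(** * Regions of a dissection *)

(** The vertices of the region whose longest edge is [e]. *)
Definition visible N (D : {set 'I_N * 'I_N}) (e : 'I_N * 'I_N) : {set 'I_N} :=
  uncovered e.1 e.2 (below D e).

(** Inverse to [visible]: recovers the longest edge of a region from its vertices. The default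
    [ord0] matters only for empty [S]. *)
Definition extremes N (S : {set 'I_N.+1}) : 'I_N.+1 * 'I_N.+1 :=
  let s0 := odflt ord0 [pick s in S] in
  ([arg min_(k < s0 in S) (k : nat)], [arg max_(k > s0 in S) (k : nat)]).

Lemma extremesP N (S : {set 'I_N.+1}) : S != set0 ->
  [/\ (extremes S).1 \in S, (extremes S).2 \in S &
      {in S, forall k : 'I_N.+1, (extremes S).1 <= k <= (extremes S).2}].
Proof.
case/set0Pn=> s sS; rewrite /extremes.
case: pickP => [s0 s0S /=|/(_ s)]; last by rewrite sS.
case: arg_minnP => // x xS hx; case: arg_maxnP => // y yS hy; split=> // k kS.
by rewrite hx //; apply: hy.
Qed.

Lemma extremes_eq N (S : {set 'I_N.+1}) e :
  e.1 \in S -> e.2 \in S -> {in S, forall k : 'I_N.+1, e.1 <= k <= e.2} ->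
  extremes S = e.
Proof.
move=> e1S e2S he.
have [x1 x2 hx] : [/\ (extremes S).1 \in S, (extremes S).2 \in S &
   {in S, forall k : 'I_N.+1, (extremes S).1 <= k <= (extremes S).2}].
  by apply: extremesP; apply/set0Pn; exists e.1.
have /andP[l1 _] := he _ x1; have /andP[_ l2] := he _ x2.
have /andP[l3 _] := hx _ e1S; have /andP[_ l4] := hx _ e2S.
by apply: arc_eq; apply/eqP; rewrite eqn_leq ?l1 ?l2 ?l3 ?l4.
Qed.

Lemma is_side_root n : is_side (ord0 : 'I_n.+3, ord_max : 'I_n.+3).
Proof. by apply/andP; split=> //=; rewrite eqxx orbT. Qed.

(** Among non-consecutive pairs only [(ord0, ord_max)] is a side, hence the extra condition. *)
Lemma is_dissection_arc_config n (D : {set 'I_n.+3 * 'I_n.+3}) :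
  is_dissection D =
  arc_config ord0 ord_max D && ((ord0, ord_max) \notin D).
Proof.
rewrite /is_dissection /arc_config -/(noncrossing D) andbAC; congr (_ && _).
apply/forall_inP/andP => [hD|[/forall_inP hD nD] e eD].
  split; last by apply/negP => /hD; rewrite /is_diagonal is_side_root andbF.
  apply/forall_inP => e /hD; rewrite /is_diagonal /is_side /is_segment.
  case/andP=> e12; rewrite e12 negb_or => /andP[ne _].
  by rewrite /= leq_ord andbT ltn_neqAle e12 eq_sym ne.
have /and3P[_ e12 _] := hD _ eD.
rewrite /is_diagonal /is_side /is_segment (ltnW e12) /=.
rewrite negb_or neq_ltn e12 orbT /=; apply/negP => /andP[/eqP e1 /eqP e2].
by case/negP: nD; rewrite (_ : (_, _) = e) //; apply: arc_eq; rewrite ?e1 ?e2.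
Qed.

Section Regions.
Variables (n : nat) (D : {set 'I_n.+3 * 'I_n.+3}).
Hypothesis dD : is_dissection D.
Let root : 'I_n.+3 * 'I_n.+3 := (ord0, ord_max).
(** The side [root] is added so that the region next to it also has its longest edge in the set. *)
Let D' := root |: D.

Let aD' : arc_config ord0 ord_max D'.
Proof.
by rewrite arc_config_setU1 //; move: dD; rewrite is_dissection_arc_config => /andP[].
Qed.

Let DsubD' e : e \in D -> e \in D'.
Proof. by move=> eD; rewrite inE eD orbT. Qed.

Lemma visibleP (e : 'I_n.+3 * 'I_n.+3) (k : 'I_n.+3) :
  reflect (e.1 <= k <= e.2 /\
    {in D', forall f : 'I_n.+3 * 'I_n.+3,
      e.1 <= f.1 -> f.2 <= e.2 -> f != e -> ~~ (f.1 < k < f.2)})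
   (k \in visible D' e).
Proof.
apply: (iffP (uncoveredP _ _ _ _)) => [] [kb h]; split=> // f.
  by move=> fD f1 f2 nf; apply: h; rewrite !inE f1 f2 nf -in_setU1 fD.
by rewrite inE => /and4P[]; apply: h.
Qed.

Lemma visible_ends e : e \in D' -> e.1 \in visible D' e /\ e.2 \in visible D' e.
Proof.
move=> eD; have [hD _] := arc_configP _ _ _ aD'; have [_ e12 _] := hD _ eD.
have a := arc_config_below e aD'.
by split; [apply: uncovered_left|apply: uncovered_right] => //; exact/ltnW/ltnW.
Qed.

Lemma extremes_visible e : e \in D' -> extremes (visible D' e) = e.
Proof.
move=> eD; have [v1 v2] := visible_ends eD.
by apply: extremes_eq => // k /visibleP[].
Qed.

Lemma is_region_visible e : e \in D' -> is_region D (visible D' e).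
Proof.
move=> eD; have [hD nD] := arc_configP _ _ _ aD'.
have [_ e12 _] := hD _ eD.
have [v1 v2] := visible_ends eD.
have aB := arc_config_below e aD'.
apply/and3P; split.
(* With only two visible vertices, [below D' e] would have length one and so contain [e] itself. *)
- have sub : [set e.1; e.2] \subset visible D' e.
    by apply/subsetP => x; rewrite in_set2 => /orP[]/eqP->.
  have := subset_leq_card sub; rewrite cards2 -val_eqE /= neq_ltn (ltnW e12) /=.
  rewrite leq_eqVlt => /orP[/eqP c2|//].
  have : top_length e.1 e.2 (below D' e) == 1.
    by rewrite /top_length -/(visible D' e) -c2.
  by rewrite top_length_eq1 // -surjective_pairing !inE eqxx !andbF.
- apply/forall_inP => f fD; have fD' := DsubD' fD.
  have := nD _ _ eD fD'; have := nD _ _ fD' eD; have [_ f12 _] := hD _ fD'.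
  rewrite /crossing /on_one_side => c1 c2.
  (* Since nothing crosses, [f] encloses [e], lies below [e], or spans an interval whose interior is
     disjoint from that of [e]. *)
  have [/andP[h1 h2]|nin] := boolP ((f.1 <= e.1) && (e.2 <= f.2)).
    apply/orP; left; apply/forall_inP => k /visibleP[kb _]; arc_lia.
  apply/orP; right; apply/forall_inP => k /visibleP[kb hk].
  have [/andP[h1 h2]|nin2] := boolP ((e.1 <= f.1) && (f.2 <= e.2)).
    apply: hk => //; by apply: contraNneq nin => ->; rewrite !leqnn.
  arc_lia.
apply/forallP => g; apply/implyP.
(* If all visible vertices lie within the span of [g], then [g] is [e]; otherwise none lies strictly
   inside it. *)
case/and4P=> gseg g1 g2 /orP[/forall_inP gall|/forall_inP gnone].
  have gE : g = e.
    have /visibleP[? _] := g1; have /visibleP[? _] := g2.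
    have := gall _ v1; have := gall _ v2 => ? ?.
    by apply: arc_eq; arc_lia.
  by move: eD; rewrite -gE !inE => /orP[/eqP->|->]; rewrite ?orbT ?is_side_root.
have [g12|g12] := leqP g.2 g.1.+1.
  rewrite /is_side gseg /= (_ : g.2 == g.1.+1 :> nat) //.
  by move: gseg; rewrite /is_segment; arc_lia.
(* The endpoints of [g] are visible, so an arc below [e] that covers a vertex strictly inside [g]
   stays within [g]. Thus [B] covers that whole interior, and [arc_of_covered] makes [g] an arc. *)
pose B := [set f in below D' e | (g.1 <= f.1) && (f.2 <= g.2)].
have aBg : arc_config g.1 g.2 B.
  apply/arc_configP; split=> [f|f f'].
    by rewrite !inE => /andP[/and4P[+ _ _ _] /andP[? ?]]; rewrite -in_setU1 => /hD[].
  rewrite !inE => /andP[/and4P[+ _ _ _] _] /andP[/and4P[+ _ _ _] _].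
  by rewrite -!in_setU1; apply: nD.
have /visibleP[g1b hg1] := g1; have /visibleP[g2b hg2] := g2.
suff : (g.1, g.2) \in B.
  rewrite -surjective_pairing !inE => /andP[/andP[/orP[/eqP->|->] _] _]; last first.
    by rewrite orbT.
  by rewrite is_side_root.
apply: arc_of_covered => // k kg.
have kV : k \notin visible D' e by apply/negP => /gnone; rewrite kg.
move: kV; rewrite inE negb_and => /orP[|]; first by move: kg g1b g2b; clear; arc_lia.
rewrite negb_forall_in => /exists_inP[f fB]; rewrite negbK => kf.
exists f => //; rewrite inE fB /=.
move: fB; rewrite inE -/D' => /and4P[fD f1 f2 nf].
have := hg1 _ fD f1 f2 nf; have := hg2 _ fD f1 f2 nf.
by move: kf kg; clear; arc_lia.
Qed.

(** The hull edge joining the extreme vertices of [S] is an arc; a visible vertex missing from [S]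
    would be cut off by the hull edge joining its neighbours in [S]. *)
Lemma region_extremes S :
  is_region D S -> extremes S \in D' /\ visible D' (extremes S) = S.
Proof.
case/and3P=> S3 /forall_inP hS /forallP hull.
have [hD nD] := arc_configP _ _ _ aD'.
have [] : [/\ (extremes S).1 \in S, (extremes S).2 \in S &
   {in S, forall k : 'I_n.+3, (extremes S).1 <= k <= (extremes S).2}].
  by apply: extremesP; rewrite -card_gt0; arc_lia.
set g := extremes S => g1 g2 gS.
have no2 (a c : 'I_n.+3) : ~ {in S, forall k : 'I_n.+3, k = a \/ k = c}.
  move=> h; have : S \subset [set a; c].
    by apply/subsetP => k /h; rewrite in_set2 => -[->|->]; rewrite eqxx ?orbT.
  move/subset_leq_card; rewrite cards2; move: S3.
  by case: (a != c) => /=; clear; arc_lia.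
have side_root (a c : 'I_n.+3) : is_side (a, c) -> a.+1 < c -> (a, c) = root.
  rewrite /is_side /is_segment /= => /andP[_ /orP[/eqP->|/andP[/eqP a0 /eqP cm]]].
    by rewrite ltnn.
  by move=> _; apply: arc_eq.
have g12 : g.1.+1 < g.2.
  rewrite ltnNge; apply/negP => le; apply: (no2 g.1 g.2) => k /gS kb.
  have : k = g.1 :> nat \/ k = g.2 :> nat by move: kb le; clear; arc_lia.
  by case=> /val_inj->; [left|right].
have gD' : g \in D'.
  have : is_hull_edge S g.
    rewrite /is_hull_edge g1 g2 /is_segment (ltnW g12) /on_one_side /=.
    by apply/orP; left; apply/forall_inP.
  move/(implyP (hull g)) => /orP[|/DsubD'//].
  by rewrite [g]surjective_pairing => /side_root-> //; rewrite setU11.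
split=> //; apply/setP => k; apply/visibleP/idP => [[kb hk]|kS]; last first.
  split=> [|f fD f1 f2 nf]; first exact: gS.
  have fD0 : f \in D.
    move: fD; rewrite !inE => /orP[/eqP fr|//]; case/eqP: nf.
    rewrite fr in f1 f2 *; apply: arc_eq; apply/eqP; rewrite eqn_leq ?f1 ?f2 //=.
    by rewrite leq_ord.
  have /orP[/forall_inP fall|/forall_inP fnone] := hS _ fD0; last exact: fnone.
  case/eqP: nf; have := fall _ g1; have := fall _ g2; clear -f1 f2 => ? ?.
  by apply: arc_eq; arc_lia.
apply/negPn/negP => kS.
have kg1 : g.1 < k.
  rewrite ltn_neqAle (andP kb).1 andbT; apply: contraNneq kS => /val_inj <- //.
have kg2 : k < g.2.
  rewrite ltn_neqAle (andP kb).2 andbT; apply: contraNneq kS => /val_inj -> //.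
(* The nearest vertices [a], [c] of [S] around [k] span a hull edge over [k]. As [k] is visible,
   that edge must be [g], which leaves [S] only two vertices. *)
have Pa : (g.1 \in S) && (g.1 < k) by rewrite g1.
have Pc : (g.2 \in S) && (k < g.2) by rewrite g2.
case: (@arg_maxnP _ g.1 (fun s => (s \in S) && (s < k)) (fun s => nat_of_ord s) Pa)
  => a /andP[aS ak] amax.
case: (@arg_minnP _ g.2 (fun s => (s \in S) && (k < s)) (fun s => nat_of_ord s) Pc)
  => c /andP[cS kc] cmin.
have none s : s \in S -> ~~ (a < s < c).
  move=> sS; apply/negP => /andP[sa sc].
  have [sk|ks|/val_inj sk] := ltngtP s k; last by rewrite -sk sS in kS.
    have := amax s; rewrite sS sk /= => /(_ isT); by rewrite leqNgt sa.
  have := cmin s; rewrite sS ks /= => /(_ isT); by rewrite leqNgt sc.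
have acD' : (a, c) \in D'.
  have : is_hull_edge S (a, c).
    rewrite /is_hull_edge aS cS /is_segment (ltn_trans ak kc) /on_one_side /=.
    by apply/orP; right; apply/forall_inP.
  move/(implyP (hull _)) => /orP[|/DsubD'//].
  by move/side_root=> ->; rewrite ?setU11 //; apply: leq_trans kc.
have := hk _ acD'; rewrite ak kc /=.
have /andP[-> _] := gS _ aS; have /andP[_ ->] := gS _ cS.
have [E|_] := eqVneq (a, c) g; last by move=> /(_ isT isT isT).
move=> _; apply: (no2 a c) => s sS; have := none _ sS; have := gS _ sS.
rewrite -E /= => sb ns.
have : s = a :> nat \/ s = c :> nat by move: sb ns; clear; arc_lia.
by case=> /val_inj->; [left|right].
Qed.

(** [visible] and [extremes] are mutually inverse between the arcs, root side included, and the
    regions. *)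
Lemma prod_regions c :
  \prod_(S | is_region D S) c #|S|.-1 = weight c ((ord0, ord_max) |: D).
Proof.
rewrite -/root -/D' (reindex_onto (visible D') (@extremes _)) /=; last first.
  by move=> S /region_extremes[].
apply: eq_big => [e|e _] //; apply/andP/idP => [[rS /eqP <-]|eD].
  by have [] := region_extremes rS.
by rewrite is_region_visible // extremes_visible.
Qed.

End Regions.

(** * Counting colored dissections *)

Lemma card_coloring b m (D : {set 'I_m * 'I_m}) :
  #|{: coloring b D}| = \prod_(S | is_region D S) b #|S|.-1.
Proof.
rewrite card_dep_ffun foldrE big_image /=.
rewrite (big_sub (fun S => is_region D S)).
by apply: eq_bigr => S _; rewrite card_ord.
Qed.

Lemma num_colored_dissectionsE r (d : 'I_r -> nat) b n :
  num_colored_dissections d b n =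
  \sum_(D : {set 'I_n.+2 * 'I_n.+2} | is_d_dissection d D)
    \prod_(S | is_region D S) b #|S|.-1.
Proof.
rewrite /num_colored_dissections card_tagged sumnE big_map big_enum /=.
rewrite (big_sub (fun D => is_d_dissection d D)).
by apply: eq_bigr => D _; rewrite card_coloring.
Qed.

(* [c k] is [b k] if [k] is one of the [d x] and [0] otherwise, so dissections with
   a region of a forbidden size contribute nothing. *)
Lemma num_colored_dissections_weight r (d : 'I_r -> nat) b n :
  injective d ->
  let c k := \sum_(x < r | d x == k) b (d x) in
  num_colored_dissections d b n =
  \sum_(D : {set 'I_n.+2 * 'I_n.+2} | is_dissection D)
    \prod_(S | is_region D S) c #|S|.-1.
Proof.
move=> dI c; rewrite num_colored_dissectionsE big_mkcondr.
apply: eq_bigr => D _ /=; case: ifP => [/forall_inP dD|/negbT].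
  apply: eq_bigr => S rS; have /existsP[x /eqP ->] := dD _ rS.
  by rewrite /c (big_pred1 x) // => y; rewrite (inj_eq dI).
rewrite negb_forall_in => /exists_inP[S rS nS].
rewrite (bigD1 S rS) /= [c _]big1 ?mul0n // => x /eqP dx.
case/negP: nS; apply/existsP; exists x; rewrite dx prednK //.
by case/and3P: rS => + _ _; apply: leq_trans.
Qed.

Lemma num_colored_dissections_total_weight r (d : 'I_r -> nat) b n :
  injective d ->
  num_colored_dissections d b n =
  total_weight (fun k => \sum_(x < r | d x == k) b (d x)) 1
    (ord0 : 'I_n.+2) ord_max.
Proof.
move=> dI; rewrite num_colored_dissections_weight //=.
case: n => [|n]; last first.
  rewrite total_weight1 //; apply: eq_big => D; first exact: is_dissection_arc_config.
  by move=> dD; apply: (prod_regions dD (fun k => \sum_(x < r | d x == k) b (d x))).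
(* For the 2-gon the empty set is the only dissection and two vertices carry no region, so both
   sides are one. *)
rewrite total_weight_unit // (big_pred1 set0) => [|D].
  rewrite big_pred0 // => S; apply/negP => /and3P[+ _ _].
  by rewrite ltnNge; have := max_card (mem S); rewrite card_ord => ->.
transitivity (arc_config ord0 ord_max D); last by rewrite arc_config_interval_unit.
rewrite /is_dissection /arc_config -/(noncrossing D); congr (_ && _).
apply: eq_forallb => -[e1 e2] /=; congr (_ ==> _).
have h1 := ltn_ord e1; have h2 := ltn_ord e2.
rewrite /is_diagonal /is_side /is_segment /=; lia.
Qed.

Local Open Scope ring_scope.

(** * Power series *)

Section PowerSeries.
Variable R : comNzRingType.
Implicit Types z w : fps R.

Lemma fps_exp1 z : fps_exp z 1 =1 z.
Proof.
move=> n; rewrite /fps_exp /= /fps_mul big_ord_recr /= big1 => [|i _].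
  by rewrite subnn /fps_one eqxx mulr1 add0r.
by rewrite /fps_one subn_eq0 leqNgt ltn_ord mulr0.
Qed.

Lemma fps_exp_at0 z k : z 0%N = 0 -> fps_exp z k 0%N = (k == 0%N)%:R.
Proof.
by case: k => [|k] z0 //; rewrite /= /fps_mul big_ord1 z0 mul0r.
Qed.

(* [z] having no constant term, the coefficient of [x^n] in [z^(k+2)] involves
   only coefficients of [z] and [z^(k+1)] strictly between [0] and [n]. *)
Lemma fps_expSS z k n : z 0%N = 0 ->
  fps_exp z k.+2 n = \sum_(1 <= i < n) z i * fps_exp z k.+1 (n - i)%N.
Proof.
move=> z0; rewrite [LHS]/= -[fps_mul z (iter _ _ _)]/(fps_exp z k.+1) /fps_mul.
rewrite -(big_mkord predT (fun i => z i * fps_exp z k.+1 (n - i)%N)).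
case: n => [|n]; first by rewrite big_nat1 z0 mul0r big_geq.
rewrite big_ltn // z0 mul0r add0r big_nat_recr // subnn fps_exp_at0 // mulr0.
exact: addr0.
Qed.

Lemma fps_exp_agree z w n : z 0%N = 0 -> w 0%N = 0 ->
  (forall m, (m < n)%N -> z m = w m) ->
  forall k m, (m < n)%N -> fps_exp z k m = fps_exp w k m.
Proof.
move=> z0 w0 zw; elim=> [//|k IHk] m mn; apply: eq_bigr => i _.
have im := ltn_ord i; rewrite zw; last by lia.
by congr (_ * _); apply: IHk; lia.
Qed.

(** As each [d x] is at least 2, the coefficient of [x^n] in [z^(d x)] depends only on coefficients
    of [z] below [n], so the equation determines them recursively. *)
Lemma solves_equation_uniq r (d : 'I_r -> nat) b z w :
  (forall x, 2 <= d x)%N ->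
  solves_equation d b z -> solves_equation d b w -> w =1 z.
Proof.
move=> d2 [z0 hz] [w0 hw]; elim/ltn_ind => n IHn.
have := hw n; rewrite hz => /esym/eqP; rewrite subr_eq => /eqP->.
rewrite -addrA -[RHS]addr0; congr (_ + _).
rewrite addrC; apply/eqP; rewrite subr_eq0; apply/eqP/eq_bigr => x _; congr (_ * _).
have := d2 x; case: (d x) => [|[|k]] // _; rewrite !fps_expSS //.
apply: eq_big_nat => i /andP[i1 ilt]; rewrite IHn //.
by congr (_ * _); apply: (fps_exp_agree (n := n)) => //; lia.
Qed.

(** Strong induction on the length [n]. The position [i] and the ambient [N] are arbitrary because
    cutting produces subintervals of the polygon. *)
Lemma total_weight_fps_exp r (d : 'I_r -> nat) b z :
  (forall x, 2 <= d x)%N ->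
  let c k := (\sum_(x < r | d x == k) b (d x))%N in
  z 0%N = 0 ->
  (forall n, z n.+1 = (total_weight c 1 (ord0 : 'I_n.+2) ord_max)%:R) ->
  forall n k N (i j : 'I_N), j = (i + n)%N :> nat ->
  (total_weight c k i j)%:R = fps_exp z k n.
Proof.
move=> d2 c z0 hz n; elim/ltn_ind: n => -[|n] IHn k N i j ijn.
  have -> : j = i by apply: val_inj; rewrite /= ijn addn0.
  by rewrite total_weight_point fps_exp_at0.
have ij : (i < j)%N by lia.
(* For exponents at least 2 a cut yields two strictly shorter intervals. [M] is left free since
   exponent 1 needs this both in ['I_N] and in the polygon defining [z]. *)
have HSS M (i' j' : 'I_M) k' : j' = (i' + n.+1)%N :> nat ->
    (total_weight c k'.+2 i' j')%:R = fps_exp z k'.+2 n.+1.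
  move=> ijn'; have lij : (i' < j')%N by lia.
  rewrite total_weight_succ // natr_sum fps_expSS //.
  pose F v := z (v - i')%N * fps_exp z k'.+1 (j' - v)%N.
  transitivity (\sum_(v : 'I_M | (i' < v < j')%N) F v).
    rewrite (bigID (fun v : 'I_M => (v < j')%N)) /= addrC big1 ?add0r => [|v].
      apply: eq_big => [v|v vb]; first by lia.
      rewrite natrM (IHn (v - i')%N) ?(IHn (j' - v)%N) ?fps_exp1 //; lia.
    (* A cut at [j'] would leave a single point for a chain of positive length. *)
    move=> vb; have -> : v = j' by apply: val_inj => /=; lia.
    by rewrite total_weight_point muln0.
  transitivity (\sum_(i'.+1 <= v < j') F v).
    rewrite -(big_mkord (fun v => i' < v < j')%N F).
    rewrite [RHS]big_nat_cond [LHS]big_nat_cond.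
    rewrite (@big_nat_widenl _ _ _ i'.+1 0) // (big_nat_widen 0 j' M);
      last by rewrite ltnW.
    by apply: eq_bigl => v; have := ltn_ord j'; lia.
  have -> : i'.+1 = (1 + i')%N by lia.
  rewrite big_addn (_ : (j' - i' = n.+1)%N); last by lia.
  apply: eq_big_nat => v vb; rewrite /F addnK; congr (_ * fps_exp _ _ _); lia.
case: k => [|[|k]]; last exact: HSS.
  by rewrite total_weight_len0 // /= /fps_one.
rewrite fps_exp1 hz.
case: n => [|n] in IHn ijn HSS *.
  by rewrite !total_weight_unit //= ijn addn1.
(* Removing the outermost arc on both sides leaves exponents [d x] on the same length, which [HSS]
   covers. *)
rewrite !total_weight1_rec //=; last by rewrite ijn; lia.
rewrite !natr_sum; apply: eq_bigr => x _; rewrite !natrM; congr (_ * _).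
by have := d2 x; case: (d x) => [|[|m]] // _; rewrite !HSS.
Qed.
End PowerSeries.


(** * The reverse series *)

Theorem theorem4p2 (R : comNzRingType) (r : nat) (d : 'I_r -> nat)
    (b : nat -> nat)
    (r_gt0 : (0 < r)%N)
    (d_decr : forall i j : 'I_r, (i < j)%N -> (d j < d i)%N)
    (d_ge2 : forall i : 'I_r, (2 <= d i)%N)
    (b_ge1 : forall i : 'I_r, (1 <= b (d i))%N) :
  is_reverse_series d b
    (fun k => if k is n.+1 then (num_colored_dissections d b n)%:R else 0 : R).
Proof.
set z : fps R := fun k => _.
have dI : injective d.
  by move=> i j dij; apply: val_inj; case: (ltngtP i j) => // /d_decr;
    rewrite dij ltnn.
have z0 : z 0%N = 0 by [].
have hz n : z n.+1 =
    (total_weight (fun k => \sum_(x < r | d x == k) b (d x))%N 1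
       (ord0 : 'I_n.+2) ord_max)%:R.
  by rewrite /z num_colored_dissections_total_weight.
have zexp := total_weight_fps_exp d_ge2 z0 hz.
suff solz : solves_equation d b z by split=> // w; apply: solves_equation_uniq.
split=> // n; apply/eqP; rewrite eq_sym subr_eq; apply/eqP.
(* Degree zero vanishes, degree one is the degenerate 2-gon, and from degree two on the equation is
   the removal of the outermost arc. *)
case: n => [|[|n]].
- rewrite z0 big1 ?addr0 // => x _; rewrite fps_exp_at0 //.
  by have := d_ge2 x; case: (d x) => // k _; rewrite mulr0.
- rewrite hz total_weight_unit // big1 ?addr0 // => x _.
  have := d_ge2 x; case: (d x) => [|[|k]] // _.
  by rewrite fps_expSS // big_geq // mulr0.
rewrite /fps_X add0r hz total_weight1_rec // natr_sum.
by apply: eq_bigr => x _; rewrite natrM (zexp n.+2).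
Qed.
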